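(* Every Hausdorff $\omega$-narrow FSIN topological group is SIN.
   Context: Let $G$ be a topological group with identity $e$ and neighbourhood filter $\mathcal N_G(e)$ of $e$. The left (respectively right) uniformity of $G$ is generated by the entourages $\{(x,y)\in G\times G: x^{-1}y\in V\}$ (respectively $\{(x,y)\in G\times G: xy^{-1}\in V\}$), where $V$ ranges over $\mathcal N_G(e)$. $G$ is SIN (balanced) if its left and right uniformities coincide; equivalently, every identity neighbourhood contains an identity neighbourhood invariant under all inner automorphisms. A function $f:G\to\mathbb R$ is left (right) uniformly continuous if it is uniformly continuous with respect to the left (right) uniformity. $G$ is FSIN (functionally balanced) if every bounded left uniformly continuous function $f:G\to\mathbb R$ is right uniformly continuous. $G$ is $\omega$-narrow if for every $V\in\mathcal N_G(e)$ there is a countable set $C\subseteq G$ such that $G=CV$. *)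

(* Defs.v *)
From HB Require Import structures.
From mathcomp Require Import all_boot all_order all_algebra.
From mathcomp Require Import all_classical all_reals all_analysis.
Import numFieldNormedType.Exports.

Set Implicit Arguments.
Unset Strict Implicit.
Unset Printing Implicit Defensive.

Local Open Scope classical_set_scope.
Local Open Scope group_scope.

HB.structure Definition PreTopologicalGroup :=
  {G of Topological G & Group G}.

HB.mixin Record PreTopologicalGroup_isTopologicalGroup G
    & PreTopologicalGroup G := {
  mulg_continuous : continuous (fun xy : G * G => xy.1 * xy.2) ;
  invg_continuous : continuous (fun x : G => x^-1)
}.

#[short(type="topologicalGroupType")]
HB.structure Definition TopologicalGroup :=
  {G of PreTopologicalGroup G & PreTopologicalGroup_isTopologicalGroup G}.

Section uniformities.
Variable G : topologicalGroupType.

Definition left_entourage : set_system (G * G) :=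
  filter_from (nbhs (1 : G)) (fun V => [set xy | V (xy.1^-1 * xy.2)]).

Definition right_entourage : set_system (G * G) :=
  filter_from (nbhs (1 : G)) (fun V => [set xy | V (xy.1 * xy.2^-1)]).

Let mulg_cvg (T : Type) (F : set_system T) (FF : Filter F) (f g : T -> G) a b :
  f @ F --> a -> g @ F --> b -> (fun t => f t * g t) @ F --> a * b.
Proof.
move=> fa gb.
apply: (@cvg_comp _ _ _ (fun t => (f t, g t)) (fun xy : G * G => xy.1 * xy.2)
  F (nbhs (a, b))); first exact: cvg_pair.
exact: (@mulg_continuous G (a, b)).
Qed.

Let split_nbhs1 (V : set G) : nbhs (1 : G) V ->
  exists2 W : set G, nbhs (1 : G) W & forall x y, W x -> W y -> V (x * y).
Proof.
move=> V1; have /= := @mulg_continuous G (1, 1) V.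
rewrite /= mulg1 => /(_ V1)[[A B] /= [A1 B1] AB].
exists (A `&` B); first exact: filterI.
by move=> x y [Ax _] [_ By]; exact: (AB (x, y)).
Qed.

Let inv_nbhs1 (V : set G) : nbhs (1 : G) V -> nbhs (1 : G) [set x | V x^-1].
Proof. by move=> V1; apply: (@invg_continuous G 1 V); rewrite invg1. Qed.

Let left_filter : Filter left_entourage.
Proof.
apply: filter_from_filter; first by exists setT; exact: filterT.
move=> V W V1 W1; exists (V `&` W); first exact: filterI.
by move=> xy [].
Qed.

Let right_filter : Filter right_entourage.
Proof.
apply: filter_from_filter; first by exists setT; exact: filterT.
move=> V W V1 W1; exists (V `&` W); first exact: filterI.
by move=> xy [].
Qed.

Let left_diagonal A : left_entourage A -> diagonal `<=` A.
Proof.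
move=> [V V1 VA] [x y] /= xy; rewrite /diagonal /= in xy; subst y.
by apply: VA => /=; rewrite mulVg; exact: nbhs_singleton.
Qed.

Let right_diagonal A : right_entourage A -> diagonal `<=` A.
Proof.
move=> [V V1 VA] [x y] /= xy; rewrite /diagonal /= in xy; subst y.
by apply: VA => /=; rewrite mulgV; exact: nbhs_singleton.
Qed.

Let left_inv A : left_entourage A -> left_entourage A^-1%relation.
Proof.
move=> [V V1 VA]; exists [set x | V x^-1]; first exact: inv_nbhs1.
by move=> [x y] /=; rewrite invgM invgK => Vyx; exact: (VA (y, x)).
Qed.

Let right_inv A : right_entourage A -> right_entourage A^-1%relation.
Proof.
move=> [V V1 VA]; exists [set x | V x^-1]; first exact: inv_nbhs1.
by move=> [x y] /=; rewrite invgM invgK => Vyx; exact: (VA (y, x)).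
Qed.

Let left_split A : left_entourage A ->
  exists2 B, left_entourage B & (B \; B)%relation `<=` A.
Proof.
move=> [V /split_nbhs1[W W1 WV] VA].
exists [set xy | W (xy.1^-1 * xy.2)]; first by exists W.
move=> [x z] [y /= Wxy Wyz]; apply: VA => /=.
by have := WV _ _ Wxy Wyz; rewrite mulgA mulgK.
Qed.

Let right_split A : right_entourage A ->
  exists2 B, right_entourage B & (B \; B)%relation `<=` A.
Proof.
move=> [V /split_nbhs1[W W1 WV] VA].
exists [set xy | W (xy.1 * xy.2^-1)]; first by exists W.
move=> [x z] [y /= Wxy Wyz]; apply: VA => /=.
by have := WV _ _ Wxy Wyz; rewrite mulgA mulgVK.
Qed.

Let left_nbhsE : @nbhs G G = nbhs_ left_entourage.
Proof.
apply/funext => x; apply/seteqP; split=> A.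
  move=> xA; exists [set yz | A (x * (yz.1^-1 * yz.2))]; last first.
    by move=> y /xsectionP /=; rewrite mulVKg.
  exists [set y | A (x * y)] => //.
  have : (fun y => x * y) @ nbhs (1 : G) --> x * 1.
    by apply: mulg_cvg; [exact: cvg_cst | exact: cvg_id].
  by rewrite mulg1; apply.
move=> [B [V V1 VB] BA].
have : (fun y => x^-1 * y) @ nbhs x --> x^-1 * x.
  by apply: mulg_cvg; [exact: cvg_cst | exact: cvg_id].
rewrite mulVg => /(_ V V1) xV.
apply: (@filterS _ _ (nbhs_filter x) _ _ _ xV) => y Vy.
by apply/BA/xsectionP; exact: VB.
Qed.

Let right_nbhsE : @nbhs G G = nbhs_ right_entourage.
Proof.
apply/funext => x; apply/seteqP; split=> A.
  move=> xA; exists [set yz | A ((yz.1 * yz.2^-1)^-1 * x)]; last first.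
    by move=> y /xsectionP /=; rewrite invgM invgK mulgVK.
  exists [set y | A (y^-1 * x)] => //.
  have : (fun y => y^-1 * x) @ nbhs (1 : G) --> 1^-1 * x.
    by apply: mulg_cvg; [exact: (@invg_continuous G 1) | exact: cvg_cst].
  by rewrite invg1 mul1g; apply.
move=> [B [V V1 VB] BA].
have : (fun y => x * y^-1) @ nbhs x --> x * x^-1.
  by apply: mulg_cvg; [exact: cvg_cst | exact: (@invg_continuous G x)].
rewrite mulgV => /(_ V V1) xV.
apply: (@filterS _ _ (nbhs_filter x) _ _ _ xV) => y Vy.
by apply/BA/xsectionP; exact: VB.
Qed.

(* Aliases of G, each with the original topology of G and one of its two
   group uniformities. *)
Definition left_uniform : Type := G.
Definition right_uniform : Type := G.

HB.instance Definition _ := Topological.on left_uniform.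
HB.instance Definition _ := Nbhs_isUniform_mixin.Build left_uniform
  left_filter left_diagonal left_inv left_split left_nbhsE.

HB.instance Definition _ := Topological.on right_uniform.
HB.instance Definition _ := Nbhs_isUniform_mixin.Build right_uniform
  right_filter right_diagonal right_inv right_split right_nbhsE.

Definition left_unif_continuous (R : realType) (f : G -> R) :=
  unif_continuous (f : left_uniform -> R).

Definition right_unif_continuous (R : realType) (f : G -> R) :=
  unif_continuous (f : right_uniform -> R).

Definition SIN := @entourage left_uniform = @entourage right_uniform.

Definition FSIN (R : realType) := forall f : G -> R,
  bounded_fun f -> left_unif_continuous f -> right_unif_continuous f.

Definition omega_narrow := forall V : set G, nbhs (1 : G) V ->
  exists2 C : set G, countable C & [set: G] = [set c * v | c in C & v in V].

End uniformities.

(* Main.v *)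
Require Import Defs.
From mathcomp Require Import all_boot all_order all_algebra.
From mathcomp Require Import all_classical all_reals all_analysis.
From mathcomp Require Import lra.
Import Order.TTheory GRing.Theory Num.Theory.
Import numFieldNormedType.Exports.

(** Bounded functions see a uniformity only through its proximity: separating
    a set [A] from the complement of [A V] by a bounded left uniformly
    continuous function, an FSIN group satisfies, for every set [A] and every
    identity neighbourhood [V], an inclusion [U A] in [A V] for some identity
    neighbourhood [U] ([FSIN_swap]).  SIN asks for [u g] in [g V] for all [u]
    in [U] and all [g] at once, and the proof consists in choosing a single [A]
    whose inclusion [U A] in [A V] forces this.  There are two ways to make such
    a choice, according to whether small neighbourhoods are precompact.

    If some small [V0] contains an infinite left separated sequence [x]
    ([conj_contains_separated]), take a maximal left separated set [D].  By
    omega-narrowness [D] is countable, so it has an injective rank [r] into the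
    natural numbers.  Let [A] be the union over [d] in [D] of the clusters
    [d x_0, ..., d x_(r d)].  Left translation by a small [u] nearly maps [A]
    into [A], so it sends each cluster injectively into one cluster; since [u^-1]
    does the same in the other direction, sizes are preserved.  Distinct
    clusters have distinct sizes, so [u] nearly fixes each [d], hence, by
    maximality of [D], every element of [G].

    If instead [V0] is precompact ([conj_contains_precompact]) and SIN fails,
    choose successively [k_n] in [V0] and [a_n] such that [k_n] is far from
    fixing [a_n] but almost fixes the earlier [a_i] and [k_i^-1 a_i].  For
    [A = {a_n}] and the corresponding [U], precompactness gives [m < n] with
    [k_m^-1 k_n] in [U].  This element sends [a_m] near [k_m^-1 a_m], which
    would have to be near some [a_l]; the way the sequences were chosen excludes
    [l < m], [l = m] and [l > m]. *)

Set Implicit Arguments.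
Unset Strict Implicit.
Unset Printing Implicit Defensive.

Local Open Scope classical_set_scope.

(** * Uniformly continuous separation *)

Section uniform_urysohn.
Local Open Scope ring_scope.
Variables (R : realType) (T : uniformType).

Lemma unif_continuous_min_edist_inf (M : pseudoMetricType R) (A : set M)
    (c : R) : 0 < c -> (forall x, edist_inf A x \is a fin_num) ->
  unif_continuous (fun x => Num.min (fine (edist_inf A x) / c) 1).
Proof.
move=> c0 fin_dist; pose d x := fine (edist_inf A x) / c.
have dist_lip e x y : 0 < e -> ball x (e * c) y -> d x <= e + d y.
  move=> e0 xy; rewrite /d ler_pdivrMr// mulrDl divfK ?gt_eqF//.
  rewrite -lee_fin EFinD !fineK//.
  apply: le_trans (edist_inf_triangle A x y) _.
  by rewrite leeD2r// edist_fin// mulr_gt0.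
apply/unif_continuousP => e e0.
have e20 : 0 < e / 2 by rewrite divr_gt0.
exists (e / 2 * c); first by rewrite mulr_gt0.
move=> [x y] /= xy.
have := dist_lip _ _ _ e20 xy; have := dist_lip _ _ _ e20 (ball_sym xy).
rewrite /ball/= -/(d x) -/(d y) => yx {}xy.
rewrite (@le_lt_trans _ _ (e / 2))//; last first.
  by rewrite ltr_pdivrMr// ltr_pMr// ltr1n.
rewrite ler_norml; apply/andP; split; rewrite /Num.min.
  by do 2 case: ltP => ?; lra.
by do 2 case: ltP => ?; lra.
Qed.

(** An entourage dominates a pseudometric whose uniformity is coarser than the
    given one.  The truncated distance to [A] is then not merely continuous but
    Lipschitz for that pseudometric. *)
Lemma uniform_urysohn (A : set T) (E : set (T * T)) : entourage E ->
  exists f : T -> R, [/\ unif_continuous f, bounded_fun f,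
    forall x, A x -> f x = 0 &
    forall x, (forall a, A a -> ~ E (a, x)) -> f x = 1].
Proof.
move=> entE; pose M : pseudoMetricType R := gauge.type entE.
have [->|/set0P[a0 Aa0]] := eqVneq A set0.
  exists (cst 1); split => //.
    move=> B entB; apply: (@filterS _ entourage _ setT _ _ filterT) => xy _.
    exact: entourage_refl.
  by exists 1; split=> // y y1 x _ /=; rewrite normr1 ltW.
have [c c0 cE] : exists2 c : R, 0 < c & forall x y : M, ball x c y -> E (x, y).
  have : @entourage M E by exists 0%N => // xy [].
  by rewrite -entourage_ballE => -[c c0 cE]; exists c => // x y; exact: (cE (x, y)).
have fin_dist x : @edist_inf R M A x \is a fin_num.
  rewrite ge0_fin_numE ?edist_inf_ge0//.
  apply: (@le_lt_trans _ _ (edist (x : M, a0 : M))).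
    by apply: ereal_inf_lbound; exists a0.
  rewrite -ge0_fin_numE ?edist_ge0//; apply/edist_finP; exists 2 => //.
  exact: countable_uniform.countable_uniform_bounded.
have dist_ge0 x : 0 <= fine (@edist_inf R M A x) / c.
  by rewrite divr_ge0 ?fine_ge0 ?edist_inf_ge0// ltW.
exists (fun x => Num.min (fine (@edist_inf R M A x) / c) 1); split.
- move=> B entB; apply: (@gauge.gauge_ent _ _ entE).
  exact: (unif_continuous_min_edist_inf c0 fin_dist entB).
- exists 1; split=> // y y1 x _ /=; rewrite ger0_norm ?le_min ?dist_ge0 ?ler01//.
  by rewrite ge_min (ltW y1) orbT.
- by move=> x Ax; rewrite edist_inf0// mul0r min_l.
move=> x farx; rewrite min_r// ler_pdivlMr// mul1r -lee_fin fineK//.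
apply: le_ereal_inf_tmp => _ [a Aa <-]; rewrite leNgt; apply/negP => ltc.
by apply: (farx a Aa); apply: cE; apply/ball_sym; exact: edist_lt_ball ltc.
Qed.

End uniform_urysohn.

(** * Identity neighbourhoods *)

Section group_nbhs.
Local Open Scope group_scope.
Variable G : topologicalGroupType.
Implicit Types (V : set G) (a : G).

Lemma nbhs1V V : nbhs (1 : G) V -> nbhs (1 : G) [set x | V x^-1].
Proof. by move=> V1; apply: (@invg_continuous G 1 V); rewrite invg1. Qed.

Lemma nbhs1J V a : nbhs (1 : G) V -> nbhs (1 : G) [set x | V (x ^ a)].
Proof.
move=> V1; have mulc := @mulg_continuous G.
have cont : {for 1, continuous (fun x : G => x ^ a)}.
  apply: (@continuous_comp _ _ _ (fun x => (a^-1, x * a))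
    (fun xy : G * G => xy.1 * xy.2)); last exact: mulc.
  apply: cvg_pair; first exact: cvg_cst.
  apply: (@continuous_comp _ _ _ (fun x => (x, a))
    (fun xy : G * G => xy.1 * xy.2)); last exact: mulc.
  by apply: cvg_pair; [exact: cvg_id | exact: cvg_cst].
by apply: cont; rewrite conj1g.
Qed.

Lemma nbhs1_split V : nbhs (1 : G) V -> exists2 W : set G, nbhs (1 : G) W &
  [/\ W 1, W `<=` V, forall x, W x -> W x^-1 &
      forall x y, W x -> W y -> V (x * y)].
Proof.
move=> V1; have := @mulg_continuous G (1, 1) V.
rewrite /= mulg1 => /(_ V1)[[A B] /= [A1 B1] AB].
pose W := A `&` B; have W1 : nbhs (1 : G) W by exact: filterI.
have We : W 1 by exact: nbhs_singleton W1.
exists (W `&` [set x | W x^-1]); first exact: filterI (nbhs1V W1).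
split=> [|x [[Ax _] _]|x [? ?]|x y [[Ax _] _] [[_ By] _]].
- by split=> //=; rewrite invg1.
- by rewrite -[x]mulg1; apply: (AB (x, 1)); case: We.
- by split=> //=; rewrite invgK.
- exact: (AB (x, y)).
Qed.

Definition conj_contains V :=
  exists2 U, nbhs (1 : G) U & forall u g, U u -> V (u ^ g).

Lemma SIN_conj_contains :
  (forall V, nbhs (1 : G) V -> conj_contains V) -> SIN G.
Proof.
have left_right (x y : G) : ((x / y) ^ x)^-1 = x^-1 * y.
  by rewrite conjgE !invgM !invgK !mulgA mulgVK.
have right_left (x y : G) : ((x^-1 * y) ^ x^-1)^-1 = x / y.
  by rewrite conjgE !invgM !invgK !mulgA mulgK.
move=> sinG; apply/seteqP; split=> A [V V1 VA];
  have [U U1 UV] := sinG _ (nbhs1V V1); exists U => // -[x y] /= Uxy; apply: VA.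
- exact: (eq_ind _ V (UV _ x Uxy) _ (left_right x y)).
- exact: (eq_ind _ V (UV _ x^-1 Uxy) _ (right_left x y)).
Qed.

(** * Left separated sets *)

Definition left_separated (S : set G) (D : set G) :=
  forall x y, D x -> D y -> S (x^-1 * y) -> x = y.

Lemma maximal_left_separated (S : set G) : S 1 -> (forall x, S x -> S x^-1) ->
  exists2 D, left_separated S D & forall g, exists2 d, D d & S (d^-1 * g).
Proof.
move=> S1 SV.
have [F Fsep Ftot|D [sepD maxD]] := @Zorn_bigcup _ (left_separated S).
  move=> x y [X FX Xx] [Y FY Yy].
  have [XY|YX] := Ftot _ _ FX FY; first exact: (Fsep _ FY) (XY _ Xx) Yy.
  exact: (Fsep _ FX) Xx (YX _ Yy).
exists D => // g; apply: contrapT => noD.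
apply: (maxD (D `|` [set g])).
  split=> [x ?|/(_ g (or_intror erefl)) Dg]; first by left.
  by apply: noD; exists g; rewrite ?mulVg.
move=> x y [Dx|->] [Dy|->] //; first exact: sepD.
  by move=> Sxg; case: noD; exists x.
by move=> /SV; rewrite invgM invgK => Syg; case: noD; exists y.
Qed.

(** A cover of [G] by countably many left translates of a small [W] has at most
    one point of [D] in each translate. *)
Lemma countable_left_separated (S D : set G) : omega_narrow G ->
  nbhs (1 : G) S -> left_separated S D -> countable D.
Proof.
move=> narrowG S1 sepD; have [W W1 [_ _ WV WS]] := nbhs1_split S1.
have [C /countable_injP[j jinj] GCW] := narrowG _ W1.
have /choice[r rP] (g : G) : exists c, C c /\ W (c^-1 * g).
  have : [set: G] g by [].
  by rewrite GCW => -[c Cc [w Ww <-]]; exists c; rewrite mulKg.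
apply/countable_injP; exists (j \o r) => x y; rewrite !inE => Dx Dy /= rxy.
have [[Crx Wx] [Cry Wy]] := (rP x, rP y).
apply: sepD => //; have {rxy} rxy : r x = r y by apply: jinj; rewrite ?inE.
rewrite -rxy in Wy; have := WS _ _ (WV _ Wx) Wy.
by rewrite invgM invgK !mulgA mulgK.
Qed.

End group_nbhs.

(** * Choice of a sequence along its history *)

Lemma history_dependent_choice (T : Type) (P : seq T -> T -> Prop) :
  (forall s, exists x, P s x) ->
  exists x : nat -> T, forall n, P (mkseq x n) (x n).
Proof.
move=> /choice[f fP]; pose hist n := iter n (fun s => rcons s (f s)) [::].
exists (f \o hist) => n.
suff -> : mkseq (f \o hist) n = hist n by exact: fP.
by elim: n => // n IHn; rewrite mkseqS IHn.
Qed.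

(** * The proximity of an FSIN group *)

Section proximity.
Local Open Scope group_scope.
Variable G : topologicalGroupType.
Implicit Types (U V W A : set G).

(** This compares the proximities of the two uniformities: sets that are far
    apart for the left one are far apart for the right one. *)
Definition swappable := forall A V, nbhs (1 : G) V ->
  exists2 U, nbhs (1 : G) U &
    forall u a, U u -> A a -> exists2 b, A b & V (b^-1 * (u * a)).

(** The function vanishing on [A] and equal to [1] off [A V] is right uniformly
    continuous, so small left translates of points of [A] cannot leave [A V]. *)
Lemma FSIN_swap (R : realType) : FSIN G R -> swappable.
Proof.
move=> fsinG A V V1; have entV : @entourage (left_uniform G)
    [set xy : G * G | V (xy.1^-1 * xy.2)] by exists V.
have [f [lucf bndf f0 f1]] := @uniform_urysohn R (left_uniform G) A _ entV.
have /= := fsinG f bndf lucf [set xy : R * R | `|xy.1 - xy.2| < 1]%R.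
case=> [|U U1 Uf].
  by rewrite -entourage_ballE; exists 1%R => //=.
exists U => // u a Uu Aa; apply: contrapT => far.
have := Uf (u * a, a); rewrite /= mulgK => /(_ Uu).
rewrite (f1 (u * a)) ?f0// ?subr0 ?normr1 ?ltxx// => b Ab Vb.
by apply: far; exists b.
Qed.

Hypothesis swapG : swappable.

(** * Precompact neighbourhoods *)

(** The hypothesis on sequences is the form of precompactness of [V0] whose
    negation provides the separated sequence of [conj_contains_separated].
    The points [k_i^-1 a_i] enter the construction because [k_m^-1 k_n], for
    [m < n], moves [a_m] to about [k_m^-1 a_m]: later [k_l] must almost fix this
    point so that [a_l], which [k_l] moves far, cannot be close to it. *)
Lemma conj_contains_precompact V0 V : nbhs (1 : G) V0 -> nbhs (1 : G) V ->
  (forall W (x : nat -> G), nbhs (1 : G) W -> (forall n, V0 (x n)) ->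
    exists m n, (m < n)%N /\ W ((x m)^-1 * x n)) ->
  conj_contains V.
Proof.
move=> V01 V1 precV0; apply: contrapT => notSIN.
have moves U : nbhs (1 : G) U -> exists ka : G * G, U ka.1 /\ ~ V (ka.1 ^ ka.2).
  move=> U1; apply: contrapT => noka; apply: notSIN; exists U => // u g Uu.
  by apply: contrapT => nVug; apply: noka; exists (u, g).
have [V2 V21 [_ V2S V2V V2M]] := nbhs1_split V1.
have [V3 V31 [_ V32 V3V V3M]] := nbhs1_split V21.
have [W W1 [_ WV3 WV WM]] := nbhs1_split V31.
(* A pair [ka] is the new [(k_n, a_n)], and [s] lists the earlier pairs. *)
pose P (s : seq (G * G)) (ka : G * G) := [/\ V0 ka.1, ~ V (ka.1 ^ ka.2) &
  forall lb, lb \in s -> W (ka.1 ^ lb.2) /\ W (ka.1 ^ (lb.1^-1 * lb.2))].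
have /history_dependent_choice[ka kaP] s : exists ka, P s ka.
  have : nbhs (1 : G) [set k | forall lb, lb \in s ->
      W (k ^ lb.2) /\ W (k ^ (lb.1^-1 * lb.2))].
    elim: s => [|lb s IHs]; first by apply: filterS filterT.
    apply: filterS (filterI (filterI (nbhs1J lb.2 W1)
      (nbhs1J (lb.1^-1 * lb.2) W1)) IHs) => k /= [klb ks] lb'.
    by rewrite inE => /predU1P[->|/ks].
  move=> /(filterI V01)/moves[x [[V0x sx] nVx]]; by exists x.
pose k n := (ka n).1; pose a n := (ka n).2.
have kV0 n : V0 (k n) by have [] := kaP n.
have kaV n : ~ V (k n ^ a n) by have [] := kaP n.
have kW i n : (i < n)%N -> W (k n ^ a i) /\ W (k n ^ ((k i)^-1 * a i)).
  move=> lin; have [_ _ /(_ (ka i))] := kaP n; apply.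
  by apply/mapP; exists i; rewrite // mem_iota.
have [U U1 Uswap] := swapG (range a) W1.
have [m [n [ltmn Umn]]] := precV0 U k U1 kV0.
have [_ [l _ <-] Wl] := Uswap _ (a m) Umn (ex_intro2 _ _ m I erefl).
have [Wnm _] := kW _ _ ltmn.
pose p := (a l)^-1 * ((k m)^-1 * a m).
have V3p : V3 p.
  have := WM _ _ Wl (WV _ Wnm); congr V3.
  by rewrite /p conjgE !invgM !invgK !mulgA !(mulgK, mulgVK).
(* [p] says that [k_m^-1 a_m] is near [a_l]. *)
have [ltlm|ltml|eqlm] := ltngtP l m.
(* [q = a_l^-1 a_m] is small and [k_m] almost fixes [a_l], hence [a_m]. *)
- have [Wml _] := kW _ _ ltlm; pose w := k m ^ a l; pose q := w * p.
  have V2q : V2 q by apply: V3M => //; exact: WV3.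
  apply: (kaV m); rewrite (_ : k m ^ a m = q^-1 * (w * q)).
    apply: V2M; first exact: V2V.
    by rewrite /q mulgA; apply: V3M => //; exact: WM.
  by rewrite /q /p /w !conjgE !invgM !invgK !mulgA !(mulgK, mulgVK).
(* [k_l] almost fixes [k_m^-1 a_m], hence the nearby [a_l]. *)
- have [_ Wlm] := kW _ _ ltml; apply: (kaV l).
  rewrite (_ : k l ^ a l = p * (k l ^ ((k m)^-1 * a m) * p^-1)).
    apply: V2M; first exact: V32.
    by apply: V3M; [exact: WV3 | exact: V3V].
  by rewrite /p !conjgE !invgM !invgK !mulgA !(mulgK, mulgVK).
(* [k_m] itself almost fixes [a_m]. *)
- apply: (kaV m); apply: V2S.
  rewrite -[_ ^ _]invgK; apply/V2V/V32; rewrite (_ : _^-1 = p)//.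
  by rewrite /p eqlm conjgE !invgM !invgK !mulgA.
Qed.

(** * Neighbourhoods with an infinite separated sequence *)

(** An infinite separated sequence in [V0] provides separated clusters of every
    finite size, and two separated clusters that are nearly translated onto each
    other have the same size.  Clusters of pairwise distinct sizes thus label
    the countably many points of [D], and swapping small elements with the
    single set of all clusters already controls each point of [D] separately. *)
Lemma conj_contains_separated V : omega_narrow G -> nbhs (1 : G) V ->
  exists2 V0 : set G, nbhs (1 : G) V0 &
    forall W (x : nat -> G), nbhs (1 : G) W -> (forall n, V0 (x n)) ->
      (forall m n, (m < n)%N -> ~ W ((x m)^-1 * x n)) ->
    conj_contains V.
Proof.
move=> narrowG V1.
have [V2 V21 [_ _ V2V V2M]] := nbhs1_split V1.
have [S S1 [Se SV2 SV SM]] := nbhs1_split V21.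
have [A A1 [_ AS AV AM]] := nbhs1_split S1.
have [B B1 [_ _ _ BM]] := nbhs1_split A1.
have [V0 V01 [_ V0B V0V V0M]] := nbhs1_split B1.
exists V0 => // W x W1 xV0 xsep.
have [D Dsep Dmax] := maximal_left_separated Se SV.
have /countable_injP[r rinj] := countable_left_separated narrowG S1 Dsep.
have [W2 W21 [_ _ W2V W2M]] := nbhs1_split W1.
have [U U1 Uswap] :=
  swapG [set g | exists d i, [/\ D d, (i <= r d)%N & g = d * x i]]
  (filterI W21 V01).
(* At most one cluster is near the image by [u] of the cluster of [d]. *)
have Duniq u d d1 d2 : D d1 -> D d2 -> A (d1^-1 * (u * d)) ->
    A (d2^-1 * (u * d)) -> d1 = d2.
  move=> Dd1 Dd2 A1d /AV A2d; apply: Dsep => //.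
  have := AM _ _ A1d A2d; congr S.
  by rewrite !invgM !invgK !mulgA !(mulgK, mulgVK).
(* The cluster of [d] goes injectively into the cluster of some [d']. *)
have shift u d : U u -> D d -> exists d', [/\ D d', A (d'^-1 * (u * d)) &
    (r d <= r d')%N].
  move=> Uu Dd.
  have swapped i : (i <= r d)%N -> exists d' j, [/\ D d', (j <= r d')%N,
      A (d'^-1 * (u * d)) & W2 ((d' * x j)^-1 * (u * (d * x i)))].
    move=> leir; have [|_ [d' [j [Dd' lejr ->]]] [W2w V0w]] := Uswap u (d * x i) Uu.
      by exists d, i.
    exists d', j; split=> //.
    have := BM _ _ (V0M _ _ (xV0 j) V0w) (V0B _ (V0V _ (xV0 i))); congr A.
    by rewrite !invgM !mulgA mulgV mul1g mulgK.
  have [d' [_ [Dd' _ Ad' _]]] := swapped 0%N isT.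
  exists d'; split=> //.
  have /choice[j jP] (i : nat) : exists j, (i <= r d)%N ->
      (j <= r d')%N /\ W2 ((d' * x j)^-1 * (u * (d * x i))).
    have [/swapped[d1 [j [Dd1 lej Ad1 W2j]]]|] := boolP (i <= r d)%N; last first.
      by exists 0%N.
    by exists j => _; rewrite (Duniq u d d' d1).
  have jinj i1 i2 : (i1 <= r d)%N -> (i2 <= r d)%N -> (i1 < i2)%N -> j i1 <> j i2.
    move=> /jP[_ W2i1] /jP[_ W2i2] lti eqj; apply: (xsep _ _ lti).
    rewrite -eqj in W2i2; have := W2M _ _ (W2V _ W2i1) W2i2; congr W.
    by rewrite !invgM !invgK !mulgA !(mulgK, mulgVK).
  rewrite -ltnS -[(r d).+1](size_iota 0) -(size_map j) -[(r d').+1](size_iota 0).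
  apply: uniq_leq_size.
    rewrite map_inj_in_uniq ?iota_uniq// => i1 i2; rewrite !mem_iota !add0n !ltnS.
    move=> /= le1 le2; have [lt12|lt21|//] := ltngtP i1 i2.
      by move=> /(jinj _ _ le1 le2 lt12).
    by move=> /esym/(jinj _ _ le2 le1 lt21).
  by move=> _ /mapP[i + ->]; rewrite !mem_iota !add0n !ltnS => /jP[].
(* Applying [shift] to [u] and then to [u^-1] leads from [d] back to [d], so the
   two clusters have the same size. *)
exists (U `&` [set u | U u^-1]); first exact: filterI (nbhs1V U1).
move=> u g [Uu UVu]; have [d Dd Sdg] := Dmax g.
have [d' [Dd' Ad' ler]] := shift u d Uu Dd.
have [d'' [Dd'' Ad'' ger]] := shift u^-1 d' UVu Dd'.
have eqd'' : d'' = d.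
  apply: (Duniq u^-1 d') => //; have := AV _ Ad'; congr A.
  by rewrite !invgM !invgK !mulgA.
have eqd' : d' = d.
  apply: rinj; rewrite ?inE//; apply/eqP.
  by rewrite eqn_leq ler andbT -eqd''.
rewrite eqd' in Ad'.
rewrite (_ : u ^ g = (d^-1 * g)^-1 * ((d^-1 * (u * d)) * (d^-1 * g))).
  by apply: V2M; [exact/V2V/SV2 | apply: SM => //; exact: AS].
by rewrite conjgE !invgM !invgK !mulgA !(mulgK, mulgVK).
Qed.

End proximity.

Theorem theorem2p3 (R : realType) (G : topologicalGroupType)
    (hausG : hausdorff_space G) (narrowG : omega_narrow G)
    (fsinG : FSIN G R) : SIN G.
Proof.
have swapG := FSIN_swap fsinG.
apply: SIN_conj_contains => V V1.
have [V0 V01 separated] := conj_contains_separated swapG narrowG V1.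
have [[W [x [W1 xV0 xsep]]]|nosep] := pselect (exists W (x : nat -> G),
    [/\ nbhs (1 : G)%g W, forall n, V0 (x n) &
      forall m n, (m < n)%N -> ~ W ((x m)^-1 * x n)%g]).
  exact: separated W1 xV0 xsep.
apply: (conj_contains_precompact swapG V01 V1) => W x W1 xV0.
apply: contrapT => noclose; apply: nosep; exists W, x; split=> // m n ltmn Wmn.
by apply: noclose; exists m, n.
Qed.
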